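(* Let $(X,T)$ be an aperiodic t.d.s. with the small boundary property (SBP). Then $(X,T)$ has the marker property.
   Context: A t.d.s. $(X,T)$ is a compact metrizable space $X$ with a homeomorphism $T:X\to X$. It is aperiodic if there are no $x\in X$ and $n\ge1$ with $T^nx=x$. For $C\subset X$ put $\mathrm{ocap}(C)=\lim_{n\to\infty}\frac1n\max_{x\in X}\sum_{i=0}^{n-1}1_C(T^ix)$. $(X,T)$ has SBP if for each $x\in X$ and each neighborhood $U$ of $x$ there is a neighborhood $V\subset U$ of $x$ with $\mathrm{ocap}(\partial V)=0$. $(X,T)$ has the marker property if for every finite set $F\subset\mathbb{Z}\setminus\{0\}$ there is an open set $U\subset X$ such that $X=\bigcup_{n\in\mathbb{Z}}T^nU$ and $U\cap T^nU=\emptyset$ for all $n\in F$. *)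

(* Defs.v *)
From HB Require Import structures.
From mathcomp Require Import all_boot all_order all_algebra.
From mathcomp Require Import all_classical all_reals all_analysis.

Set Implicit Arguments.
Unset Strict Implicit.
Unset Printing Implicit Defensive.

Import Order.TTheory GRing.Theory Num.Theory.
Import numFieldNormedType.Exports.

Local Open Scope classical_set_scope.
Local Open Scope ring_scope.

Definition is_metric (R : realType) (X : Type) (d : X -> X -> R) : Prop :=
  [/\ forall x y, d x y = 0 <-> x = y,
      forall x y, d x y = d y x &
      forall x y z, d x z <= d x y + d y z].

Definition metrizable (R : realType) (X : topologicalType) : Prop :=
  exists2 d : X -> X -> R, is_metric d &
    forall (x : X) (A : set X),
      nbhs x A <-> exists2 e : R, 0 < e & [set y | d x y < e] `<=` A.

Definition homeomorphism (X Y : topologicalType) (f : X -> Y) : Prop :=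
  continuous f /\
  exists g : Y -> X, [/\ continuous g, cancel f g & cancel g f].

(* t.d.s. = topological dynamical system *)
Definition tds (R : realType) (X : topologicalType) (T : X -> X) : Prop :=
  [/\ compact [set: X], metrizable R X & homeomorphism T].

Definition aperiodic (X : Type) (T : X -> X) : Prop :=
  ~ exists (x : X) (n : nat), (1 <= n)%N /\ iter n T x = x.

(* The set T^n U for n in Z.  When T is a bijection, T^(-k) U is the preimage
   of U under T^k, which avoids naming the inverse map. *)
Definition iterz_image (X : Type) (T : X -> X) (n : int) (U : set X) : set X :=
  match n with
  | Posz k => iter k T @` U
  | Negz k => iter k.+1 T @^-1` U
  end.

Definition boundary (X : topologicalType) (A : set X) : set X :=
  closure A `\` A°.

Definition visits (R : realType) (X : Type) (T : X -> X) (C : set X)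
    (n : nat) (x : X) : R :=
  \sum_(0 <= i < n) \1_C (iter i T x).

(* [visits R T C n] takes values in {0, ..., n}, so for X nonempty the supremum
   is a maximum: see [max_visits_attained] below. *)
Definition max_visits (R : realType) (X : Type) (T : X -> X) (C : set X)
    (n : nat) : R :=
  sup (range (visits R T C n)).

(* The limit exists for all T and C: see [is_cvg_ocap] below. *)
Definition ocap (R : realType) (X : Type) (T : X -> X) (C : set X) : R :=
  lim ((n%:R^-1 * max_visits R T C n) @[n --> \oo]).

Definition small_boundary_property (R : realType) (X : topologicalType)
    (T : X -> X) : Prop :=
  forall (x : X) (U : set X), nbhs x U ->
    exists V : set X, [/\ nbhs x V, V `<=` U & ocap R T (boundary V) = 0].

Definition marker_property (X : topologicalType) (T : X -> X) : Prop :=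
  forall F : set int, finite_set F -> F `<=` [set n | n != 0] ->
    exists U : set X,
      [/\ open U,
          [set: X] = \bigcup_(n in [set: int]) iterz_image T n U &
          forall n : int, F n -> U `&` iterz_image T n U = set0].

Section ocap_limit.
Context (R : realType) (X : Type) (T : X -> X) (C : set X).

Lemma visits_ge0 n x : 0 <= visits R T C n x.
Proof. by apply: sumr_ge0 => i _; rewrite indicE ler0n. Qed.

Lemma visits_le n x : visits R T C n x <= n%:R.
Proof.
rewrite /visits big_mkord.
apply: (@le_trans _ _ (\sum_(i < n) (1 : R))).
  by apply: ler_sum => i _; rewrite indicE lern1 leq_b1.
by rewrite sumr_const card_ord.
Qed.

Lemma visitsD m n x :
  visits R T C (m + n) x = visits R T C m x + visits R T C n (iter m T x).
Proof.
rewrite /visits !big_mkord big_split_ord /=; congr (_ + _).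
by apply: eq_bigr => i _; rewrite addnC iterD.
Qed.

Lemma visits_ub n : has_ubound (range (visits R T C n)).
Proof. by exists n%:R => _ [x _ <-]; exact: visits_le. Qed.

Lemma visits_le_max n x : visits R T C n x <= max_visits R T C n.
Proof. by apply: ub_le_sup; [exact: visits_ub|exists x]. Qed.

Lemma max_visits_attained (x0 : X) n :
  exists x, max_visits R T C n = visits R T C n x.
Proof.
pose f x := (\sum_(0 <= i < n) (iter i T x \in C : nat))%N.
have vE x : visits R T C n x = (f x)%:R.
  by rewrite /visits natr_sum; apply: eq_bigr => i _; rewrite indicE.
have exP : exists k, `[< exists x, f x = k >] by exists (f x0); apply/asboolP; exists x0.
have ubP k : `[< exists x, f x = k >] -> (k <= n)%N.
  by move=> /asboolP[x <-]; rewrite -(ler_nat R) -vE visits_le.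
have [k /asboolP[x fx] kmax] := ex_maxnP exP ubP.
exists x; apply/eqP; rewrite eq_le visits_le_max andbT.
apply: ge_sup; first by exists (visits R T C n x0), x0.
move=> _ [y _ <-]; rewrite !vE ler_nat fx; apply: kmax.
by apply/asboolP; exists y.
Qed.

Lemma is_cvg_ocap : cvg ((n%:R^-1 * max_visits R T C n) @[n --> \oo]).
Proof.
have [[x0 _]|X0] := pselect (exists x : X, True); last first.
  have a0 n : max_visits R T C n = 0.
    rewrite /max_visits; suff -> : range (visits R T C n) = set0 by exact: sup0.
    by rewrite -subset0 => ? [x _ _]; apply: X0; exists x.
  by under eq_fun do rewrite a0 mulr0; exact: is_cvg_cst.
set a := max_visits R T C.
have a0 n : 0 <= a n by apply: le_trans (visits_le_max n x0); exact: visits_ge0.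
have an n : a n <= n%:R.
  by have [x] := max_visits_attained x0 n; rewrite /a => ->; exact: visits_le.
have aD m n : a (m + n)%N <= a m + a n.
  have [x] := max_visits_attained x0 (m + n); rewrite /a => ->.
  by rewrite visitsD lerD// visits_le_max.
have aM q m : a (q * m)%N <= q%:R * a m.
  elim: q => [|q IH]; first by rewrite mul0n mul0r; exact: an.
  by rewrite mulSn mulrSr mulrDl mul1r addrC (le_trans (aD _ _))// lerD2l.
pose E := [set m.+1%:R^-1 * a m.+1 | m in [set: nat]].
have E0 : E !=set0 by exists (1%:R^-1 * a 1%N), 0%N.
have lbE : has_lbound E.
  by exists 0 => _ [m _ <-]; rewrite mulr_ge0// invr_ge0 ler0n.
apply/cvg_ex; exists (inf E); apply/cvgrPdist_lt => e e0.
have e20 : 0 < e / 2 by rewrite divr_gt0.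
have [_ [m _ <-] mE] := inf_adherent e20 (conj E0 lbE).
have mpos : 0 < m.+1%:R :> R by rewrite ltr0n.
exists (Num.truncn (m.+1%:R / (e / 2))).+1 => // n /= nN.
have n0 : (0 < n)%N by exact: leq_trans nN.
have npos : 0 < n%:R :> R by rewrite ltr0n.
have mn : m.+1%:R / n%:R < e / 2 :> R.
  rewrite ltr_pdivrMr// mulrC -ltr_pdivrMr//.
  by rewrite (lt_le_trans (truncnS_gt _))// ler_nat.
have lo : inf E <= n%:R^-1 * a n.
  by apply: ge_inf => //; exists n.-1 => //; rewrite prednK.
have hi : n%:R^-1 * a n <= m.+1%:R^-1 * a m.+1 + m.+1%:R / n%:R.
  rewrite mulrC ler_pdivrMr// mulrDl divfK ?gt_eqF//.
  rewrite {1}(divn_eq n m.+1) (le_trans (aD _ _))// lerD//; last first.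
    by rewrite (le_trans (an _))// ler_nat ltnW// ltn_pmod.
  rewrite (le_trans (aM _ _))// mulrAC ler_wpM2r// mulrC ler_pdivlMr//.
  by rewrite -natrM ler_nat leq_divM.
rewrite distrC ger0_norm ?subr_ge0// ltrBlDl (le_lt_trans hi)//.
by rewrite [in ltRHS](splitr e) addrA ltrD.
Qed.

End ocap_limit.

(* Main.v *)
From HB Require Import structures.
Require Import Defs.
From mathcomp Require Import all_boot all_order all_algebra.
From mathcomp Require Import all_classical all_reals all_analysis.
From mathcomp Require Import zify.

Import Order.TTheory GRing.Theory Num.Theory.

Local Open Scope classical_set_scope.
Local Open Scope ring_scope.

(** Cover X by finitely many open sets V_1, ..., V_m whose boundaries have zero
    orbit capacity and which are disjoint from their first N translates.  As in
    the zero-dimensional case, put greedily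
    U_(k+1) = U_k `|` (V_(k+1) minus the union of T^n (closure U_k), |n| <= N).
    A point that the translates of U_m miss lies in a finite union of translates
    of the boundaries of the V_i.  That union still has zero orbit capacity, so no
    orbit stays in it: every orbit meets a translate of U_m. *)

(* Equivalent to [ocap R T C = 0], phrased without the limit and the supremum. *)
Definition orbit_null (R : realType) {X : Type} (T : X -> X) (C : set X) :=
  forall e : R, 0 < e -> exists N : nat, forall n, (N <= n)%N ->
  forall x, visits R T C n x <= e * n%:R.

Section orbit_null_theory.
Context {R : realType} {X : Type} {T : X -> X}.
Local Notation null := (orbit_null R T).

Lemma ocap0_null (C : set X) : ocap R T C = 0 -> null C.
Proof.
move=> C0 e e0; have := is_cvg_ocap (R := R) (T := T) (C := C).
rewrite -/(ocap R T C) C0 => /cvgrPdist_le/(_ _ e0)[N _ NP].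
(* The successor forces [n > 0], so that the factor [1/n] can be cleared. *)
exists N.+1 => n Nn x; have n0 : 0 < n%:R :> R by rewrite ltr0n; lia.
apply: le_trans (visits_le_max R T C n x) _.
have /= := NP n (ltnW Nn); rewrite sub0r normrN => /(le_trans (ler_norm _)).
by rewrite ler_pdivrMl// mulrC.
Qed.

Lemma null_sub {A B : set X} : A `<=` B -> null B -> null A.
Proof.
move=> AB nB e e0; have [N NP] := nB e e0; exists N => n Nn x.
apply: le_trans (NP n Nn x); apply: ler_sum => i _.
rewrite !indicE ler_nat; case: (boolP (_ \in A)) => //.
by rewrite inE => /AB/mem_set ->.
Qed.

Lemma null_set0 : null set0.
Proof.
move=> e e0; exists 0%N => n _ x; rewrite /visits big1 ?(mulr_ge0 (ltW e0))//.
by move=> i _; rewrite indic0.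
Qed.

Lemma nullU {A B : set X} : null A -> null B -> null (A `|` B).
Proof.
move=> nA nB e e0; have e2 : 0 < e / 2 by rewrite divr_gt0.
have [N NP] := nA _ e2; have [M MP] := nB _ e2.
exists (maxn N M) => n; rewrite geq_max => /andP[Nn Mn] x.
rewrite [e]splitr mulrDl (le_trans _ (lerD (NP n Nn x) (MP n Mn x)))//.
rewrite /visits -big_split/=; apply: ler_sum => i _.
by rewrite !indicE in_setU -natrD ler_nat; case: (_ \in A); case: (_ \in B).
Qed.

Lemma null_bigcup (C : nat -> set X) N :
  (forall k, null (C k)) -> null (\bigcup_(k < N) C k).
Proof.
move=> nC; elim: N => [|N IH]; first by rewrite bigcup_mkord big_ord0; exact: null_set0.
by rewrite bigcup_mkord big_ord_recr/= -bigcup_mkord; exact: nullU.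
Qed.

(** Since [g] commutes with [T], the visits of [x] to the preimage are those of [g x] to [C], and
    the bound in [orbit_null] is uniform in the starting point. This serves for [g] an iterate of
    [T] or of its inverse. *)
Lemma null_preimage {g : X -> X} {C : set X} :
  (forall x, g (T x) = T (g x)) -> null C -> null (g @^-1` C).
Proof.
move=> gT nC e e0; have [N NP] := nC e e0; exists N => n Nn x.
suff -> : visits R T (g @^-1` C) n x = visits R T C n (g x) by exact: NP.
have giter i : g (iter i T x) = iter i T (g x).
  by elim: i => //= i <-.
by apply: eq_bigr => i _; rewrite !indicE -giter.
Qed.

(** An orbit that stays in [B] makes [n] visits in time [n], which exceeds the bound [n / 2] for
    large [n]. *)
Lemma null_escape {B : set X} : null B -> forall x, exists i, ~ B (iter i T x).
Proof.
move=> nB x; apply: contrapT => /forallNP Bx.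
have [N NP] := nB 2^-1 ltac:(by rewrite invr_gt0).
have := NP N.+1 (leqnSn N) x; rewrite /visits.
rewrite (eq_bigr (fun=> 1)); last first.
  by move=> i _; rewrite indicE mem_set//; apply: contrapT; exact: Bx.
rewrite big_mkord sumr_const card_ord ler_pMl ?ltr0n//.
by rewrite invf_ge1// lern1.
Qed.

End orbit_null_theory.

Lemma compact_finite_cover {X : topologicalType} (P : set (set X)) :
    compact [set: X] ->
    (forall x, exists V, [/\ P V, open V & V x]) ->
  exists s : seq (set X), (forall V, V \in s -> P V /\ open V) /\
    forall x, exists2 V, V \in s & V x.
Proof.
move=> cX Pcov; have [[x0 _]|X0] := pselect (exists x : X, True); last first.
  by exists [::]; split=> // x; case: X0; exists x.
(* [compact_cover] is only stated for pointed spaces. *)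
pose pX : ptopologicalType := HB.pack X (isPointed.Build X x0).
have : cover_compact (T := pX) [set: pX] by rewrite -compact_cover.
move=> /(_ _ [set V | P V /\ open V] id) [V [_ oV]//|x _|D DP Dcov].
  by have [V [PV oV Vx]] := Pcov x; exists V.
exists (finmap.enum_fset D); split=> [V VD|x]; first by have := DP V VD; rewrite inE.
by have [V VD Vx] := Dcov x I; exists V.
Qed.

Section marker.
Context {R : realType} {X : topologicalType} {T S : X -> X}.
Hypotheses (cT : continuous T) (cS : continuous S).
Hypotheses (TK : cancel T S) (SK : cancel S T).
Local Notation null := (orbit_null R T).

Lemma iterTK k : cancel (iter k T) (iter k S).
Proof. by elim: k => // k IH x; rewrite [iter _ S _]iterSr /= TK IH. Qed.

Lemma iterSK k : cancel (iter k S) (iter k T).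
Proof. by elim: k => // k IH x; rewrite [iter _ T _]iterSr /= SK IH. Qed.

Lemma continuous_iter {f : X -> X} k : continuous f -> continuous (iter k f).
Proof.
move=> cf; elim: k => [|k IH] x; first exact: cvg_id.
by apply: continuous_comp; [exact: IH|exact: cf].
Qed.

(** Both time directions are taken as preimages, under [T] and its inverse [S], so that continuity
    alone transfers openness and closedness from [A]. *)
Definition translates N (A : set X) :=
  \bigcup_(k < N.+1) (iter k T @^-1` A `|` iter k S @^-1` A).

Lemma translates_open N A : open A -> open (translates N A).
Proof.
move=> oA; apply: bigcup_open => k _; apply: openU;
by apply: open_comp => // x _; exact: continuous_iter.
Qed.

Lemma translates_closed N A : closed A -> closed (translates N A).
Proof.
move=> oA; apply: closed_bigcup => // k _; apply: closedU;
by apply: closed_comp => // x _; exact: continuous_iter.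
Qed.

Lemma translatesU N A B : translates N (A `|` B) = translates N A `|` translates N B.
Proof.
by rewrite -bigcupU; apply: eq_bigcupr => k _; rewrite !preimage_setU setUACA.
Qed.

Lemma translates_null {N A} : null A -> null (translates N A).
Proof.
move=> nA; apply: null_bigcup => k; apply: nullU; apply: null_preimage => // x.
  by rewrite -iterSr.
by elim: k => //= k ->; rewrite TK SK.
Qed.

(** Positive times suffice: if [x] and [T^(-n) x] both lie in [U], the condition already fails at
    [T^(-n) x]. *)
Definition separated N (U : set X) :=
  forall n x, (0 < n <= N)%N -> U x -> ~ U (iter n T x).

(** Removing translates of [closure U] rather than of [U] keeps [W] open; the price is the points of
    [V] in translates of the boundary of [U], which the last clause sets apart. For an open set the
    boundary is the closure minus the set. *)
Lemma enlarge_marker N (U V : set X) :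
    open U -> null (closure U `\` U) -> separated N U ->
    open V -> null (closure V `\` V) -> separated N V ->
  exists W, [/\ open W, null (closure W `\` W), separated N W, U `<=` W &
    V `<=` translates N (closure U `\` U) `|` translates N W].
Proof.
move=> oU nU sU oV nV sV.
pose F := translates N (closure U); pose D := V `\` F.
have cF : closed F by apply: translates_closed; exact: closed_closure.
have UF : U `<=` F.
  by move=> x Ux; exists 0%N => //; left; exact: subset_closure.
have FE : F = translates N U `|` translates N (closure U `\` U).
  by rewrite -translatesU setDUK//; exact: subset_closure.
have oD : open D by apply: openI => //; exact: closed_openC.
exists (U `|` D); split.
- exact: openU.
(* A boundary point of [D] that lies in [V] must lie in [F]. It avoids the open set
   [translates N U], which would otherwise meet [D], so it lies in a translate of the boundary of
   [U]. *)
- apply: null_sub (nullU nU (nullU nV (translates_null (N := N) nU))).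
  rewrite closureU => x [[Ux|Dx] /not_orP[nUx nDx]]; first by left.
  right; have Vx : closure V x by apply: closure_subset Dx => ? [].
  have [Vx'|] := pselect (V x); last by left.
  right; have : F x by apply: contrapT => nFx; exact: nDx.
  rewrite FE => -[tUx|//]; exfalso.
  have /Dx[y [[_ nFy] tUy]] : nbhs x (translates N U).
    by apply: open_nbhs_nbhs; split=> //; exact: translates_open.
  by apply: nFy; rewrite FE; left.
(* In the two mixed cases one of [x], [T^n x] is in [U] and the other in [D]; excluding both uses
   both time directions in [translates]. *)
- move=> n x nN [Ux|[Vx nFx]] [Unx|[Vnx nFnx]].
  + exact: sU nN Ux Unx.
  + apply: nFnx; exists n => /=; first lia.
    by right; rewrite iterTK; exact: subset_closure.
  + by apply: nFx; exists n => /=; [lia|left; exact: subset_closure].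
  + exact: sV nN Vx Vnx.
- by move=> x; left.
- move=> x Vx; have [|nFx] := pselect (F x).
    by rewrite FE translatesU => -[]; [right; left|left].
  by right; exists 0%N => //; left; right.
Qed.

(** Induction on [s]: [B] collects the boundary translates lost at each stage, and since [U] only
    grows, what was covered earlier stays covered. *)
Lemma marker_of_cover N (s : seq (set X)) :
    (forall V, V \in s ->
      [/\ open V, null (closure V `\` V) & separated N V]) ->
  exists U B, [/\ open U, null (closure U `\` U), separated N U, null B &
    forall V, V \in s -> V `<=` B `|` translates N U].
Proof.
elim: s => [_|V s IH sP].
  exists set0, set0; rewrite closure0 setD0.
  by split => //; [exact: open0|exact: null_set0|exact: null_set0].
have [|U [B [oU nU sU nB cov]]] := IH.
  by move=> W Ws; apply: sP; rewrite inE Ws orbT.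
have [oV nV sV] := sP V (mem_head _ _).
have [W [oW nW sW UW VW]] := enlarge_marker N U V oU nU sU oV nV sV.
exists W, (B `|` translates N (closure U `\` U)); split => //.
  by apply: nullU => //; exact: translates_null.
move=> A; rewrite inE => /orP[/eqP -> x /VW[]|As x /(cov A As)[]].
- by left; right.
- by right.
- by left; left.
- move=> [k kN tx]; right; exists k => //.
  by case: tx => /= ?; [left|right]; exact: UW.
Qed.

Lemma iterz_cover (U : set X) x k :
  U (iter k T x) \/ U (iter k S x) -> (\bigcup_n iterz_image T n U) x.
Proof.
move=> [Ux|Ux].
  (* [Negz k] stands for [-(k+1)], so time zero needs the integer [0]. *)
  by case: k Ux => [Ux|k Ux]; [exists 0; last exists x|exists (Negz k)].
by exists k%:Z => //=; exists (iter k S x); rewrite ?iterSK.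
Qed.

(** The union over all integers is [T]-invariant: replacing [T x] by [x] lowers the exponent by one,
    and the cases follow the sign change at [0]. *)
Lemma iterz_cover_orbit (U : set X) i x :
  (\bigcup_n iterz_image T n U) (iter i T x) -> (\bigcup_n iterz_image T n U) x.
Proof.
elim: i => // i IH /= [n _ Un]; apply: IH; move: (iter i T x) Un => {}x.
case: n => [[|k] [y Uy]|k /= Uk].
- move=> /= yx; apply: (iterz_cover U _ 1); left => /=.
  by rewrite -yx.
- move=> /= /(can_inj TK) <-; apply: (iterz_cover U _ k).
  by right; rewrite iterTK.
- by apply: (iterz_cover U _ k.+2); left; rewrite iterSr.
Qed.

Lemma separated_iterz {N U} (n : int) :
  separated N U -> n != 0 -> (`|n| <= N)%N -> U `&` iterz_image T n U = set0.
Proof.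
move=> sU n0 nN; rewrite -subset0 => x [Ux]; case: n n0 nN => k k0 kN /=.
  by move=> [y Uy yx]; apply: (sU k y _ Uy); [lia|rewrite yx].
by apply: (sU k.+1 x _ Ux); lia.
Qed.

End marker.

Lemma aperiodic_separated_nbhs {R : realType} {X : topologicalType}
    {T : X -> X} (N : nat) (x : X) :
    metrizable R X -> continuous T -> aperiodic T ->
  exists2 W, nbhs x W & separated (T := T) N W.
Proof.
move=> [d [d0 dC dD] dnbhs] cT aT; elim: N => [|N [W nW sW]].
  by exists setT; [exact: filterT|move=> n ? /andP[]; case: n].
have d_ge0 y z : 0 <= d y z.
  have := dD y z y; rewrite (dC z y) (proj2 (d0 y y) erefl).
  by rewrite -mulr2n pmulrn_lge0.
(* With half the distance as radius, the balls about [x] and [T^(N+1) x] are disjoint; [T^(N+1)]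
   will send the new neighbourhood, itself inside the first ball, into the second. *)
pose e := d x (iter N.+1 T x) / 2.
have e0 : 0 < e.
  rewrite divr_gt0// lt_neqAle d_ge0 andbT eq_sym; apply/eqP => /d0 xN.
  by apply: aT; exists x, N.+1.
have nball y : nbhs y [set z | d y z < e] by apply/dnbhs; exists e.
exists (W `&` ([set z | d x z < e] `&`
    iter N.+1 T @^-1` [set z | d (iter N.+1 T x) z < e])).
  apply: filterI => //; apply: filterI; first exact: nball.
  by apply: (continuous_iter N.+1 cT x); exact: nball.
move=> n y nN [Wy [_ yN]] [Wny [xny _]].
have [nN'|/negP nN'] := boolP (n <= N)%N; first by apply: (sW n y) => //; lia.
have nE : n = N.+1 by lia.
subst n; have := dD x (iter N.+1 T y) (iter N.+1 T x).
rewrite (dC (iter _ T y)); apply/negP; rewrite -ltNge.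
by rewrite [ltRHS]splitr ltrD.
Qed.

Theorem propositionA1 (R : realType) (X : topologicalType) (T : X -> X) :
  tds R T -> aperiodic T -> small_boundary_property R T -> marker_property T.
Proof.
move=> [cX mX [cT [S [cS TK SK]]]] aT sbp F /finite_seqP[r Fr] F0.
pose N := (\max_(n <- r) `|n|)%N.
have [x|s [sP scov]] := compact_finite_cover
    [set V | orbit_null R T (closure V `\` V) /\ separated (T := T) N V] cX.
  have [W nW sW] := aperiodic_separated_nbhs N x mX cT aT.
  (* [V] need not be open. Its interior is used instead, whose boundary is contained in that of
     [V]. *)
  have [V [nV VW V0]] := sbp x W nW; exists V°.
  split; [split|exact: open_interior|exact: nV].
    apply: null_sub (ocap0_null _ V0); apply: setSD.
    by apply: closure_subset; exact: interior_subset.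
  move=> n y nN /interior_subset/VW Wy /interior_subset/VW.
  exact: sW nN Wy.
have [V Vs|U [B [oU _ sU nB cov]]] := marker_of_cover (R := R) cT cS TK SK N s.
  by have [[]] := sP V Vs.
exists U; split=> //.
(* At a time [i] when the orbit is outside [B], the cover puts [T^i x] in a translate of [U];
   invariance brings this back to [x]. *)
- apply/esym; rewrite -subTset => x _; have [i nBi] := null_escape nB x.
  have [V Vs /(cov V Vs)[//|[k _ tx]]] := scov (iter i T x).
  by apply: (iterz_cover_orbit TK SK U i); apply: (iterz_cover SK U _ k tx).
- move=> n Fn; apply: (separated_iterz n sU (F0 n Fn)).
  by apply: leq_bigmax_seq => //; move: Fn; rewrite Fr.
Qed.
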